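(* Let $\beta>\beta_c$ and $\delta>0$, and let $(k_N)$ be a sequence of positive integers such that, as $N\to\infty$, $$k_N\uparrow\infty,\qquad \frac{k_N}{N}\uparrow\infty,\qquad \frac{\log k_N}{N}\downarrow 0 .$$ Then there exist $N_0$ and, for all $N>N_0$, an event $\Omega_N\subset\Omega$ such that $$\mathbb P[\Omega_N]\ge 1-\frac{4}{(N\log 2)^{1+\delta}}$$ and on $\Omega_N$, for every $\Psi:\{-1,+1\}^N\to\mathbb R$, $$\mu_{N,\beta}(\Psi)=\frac{\sum_{i=1}^{k_N}\Psi((\tilde\sigma)_i)\exp\left(-\frac{\beta}{\beta_c}\sqrt{2\log 2^N}\,(X_{i,2^N}-X_{1,2^N})\right)+B_N(\Psi)}{\sum_{i=1}^{k_N}\exp\left(-\frac{\beta}{\beta_c}\sqrt{2\log 2^N}\,(X_{i,2^N}-X_{1,2^N})\right)+B_N(1)}$$ with $$|B_N(\Psi)|\ \le\ \frac{2\|\Psi\|_\infty}{\beta/\beta_c-1}\;\frac{1}{(k_N-1)^{(\beta/\beta_c-1)/2}},$$ where $$B_N(\Psi):=\sum_{i=k_N+1}^{2^N}\Psi((\tilde\sigma)_i)\exp\left(-\frac{\beta}{\beta_c}\sqrt{2\log 2^N}\,(X_{i,2^N}-X_{1,2^N})\right).$$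
   Context: $\beta_c:=\sqrt{2\log 2}$. For each $N$, let $\{(\sigma)_i:1\le i\le 2^N\}$ be an enumeration of $\{-1,+1\}^N$ and let $(X_i)_{1\le i\le 2^N}$ be i.i.d. standard Gaussian random variables on a probability space $(\Omega,\Sigma,\mathbb P)$, $X_i$ being attached to $(\sigma)_i$. The Gibbs measure of the random energy model is the random probability measure on $\{-1,+1\}^N$ given by $$\mu_{N,\beta}(\Psi)=\frac{\sum_{i=1}^{2^N}\Psi((\sigma)_i)e^{-\beta\sqrt N X_i}}{\sum_{i=1}^{2^N}e^{-\beta\sqrt N X_i}},\qquad \Psi:\{-1,+1\}^N\to\mathbb R .$$ Note $\beta\sqrt N=\frac{\beta}{\beta_c}\sqrt{2\log 2^N}$. $X_{1,2^N}\le\cdots\le X_{2^N,2^N}$ are the order statistics of $(X_i)$, and $(\tilde\sigma)_j$ denotes the (almost surely unique) configuration $(\sigma)_i$ with $X_i=X_{j,2^N}$. $\|\Psi\|_\infty:=\sup_{\sigma}|\Psi(\sigma)|$. *)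

(* Defs.v *)
From mathcomp Require Import all_boot all_order all_algebra.
From mathcomp Require Import all_classical all_reals all_analysis.
Set Implicit Arguments.
Unset Strict Implicit.
Unset Printing Implicit Defensive.
Import Order.TTheory GRing.Theory Num.Theory.
Import numFieldNormedType.Exports.
Local Open Scope classical_set_scope.
Local Open Scope ring_scope.

Definition spin : Type := seq_sub [:: -1; 1 : int].

Definition config (N : nat) : Type := {ffun 'I_N -> spin}.

Definition plus_spin : spin := SeqSub (mem_last (-1) [:: 1 : int]).

Definition all_plus (N : nat) : config N := [ffun => plus_spin].

Definition independent_RVs d (T : measurableType d) (R : realType)
    (P : probability T R) (I : finType) (X : I -> {RV P >-> R}) : Prop :=
  forall (J : {set I}) (A : I -> set R), (forall i, measurable (A i)) ->
    P (\bigcap_(i in [set` J]) (X i @^-1` A i)) =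
    (\prod_(i in J) P (X i @^-1` A i))%E.

Definition standard_gaussian d (T : measurableType d) (R : realType)
    (P : probability T R) (X : {RV P >-> R}) : Prop :=
  forall A : set R, measurable A -> distribution P X A = normal_prob 0 1 A.

Section REM.
Variable R : realType.

Definition beta_c : R := Num.sqrt (2 * ln 2).

(* Order statistics X_{1,n} <= ... <= X_{n,n} of a finite family; the index j
   starts at 1. *)
Definition order_stat n (x : 'I_n -> R) (j : nat) : R :=
  nth 0 (sort <=%O [seq x i | i <- enum 'I_n]) j.-1.

Definition increasing_order n (x : 'I_n -> R) : seq 'I_n :=
  sort (fun i j => x i <= x j) (enum 'I_n).

(* The configuration attached to the j-th smallest value (j >= 1); ties, which
   have probability 0, are broken by the enumeration order. The value all_plus
   is a junk value for j > 2 ^ N. *)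
Definition sigma_tilde N (sigma : 'I_(2 ^ N) -> config N) (x : 'I_(2 ^ N) -> R)
    (j : nat) : config N :=
  nth (all_plus N) [seq sigma i | i <- increasing_order x] j.-1.

Lemma order_stat_increasing_order n (x : 'I_n -> R) (j : nat) :
  order_stat x j = nth 0 [seq x i | i <- increasing_order x] j.-1.
Proof. by rewrite /order_stat sort_map. Qed.

Lemma sigma_tildeP N (sigma : 'I_(2 ^ N) -> config N) (x : 'I_(2 ^ N) -> R)
    (j : nat) : (0 < j <= 2 ^ N)%N ->
  exists2 i, sigma_tilde sigma x j = sigma i & x i = order_stat x j.
Proof.
case: j => // j /= j_lt.
have szj : (j < size (increasing_order x))%N by rewrite size_sort size_enum_ord.
exists (nth (Ordinal j_lt) (increasing_order x) j).
  by rewrite /sigma_tilde (nth_map (Ordinal j_lt)).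
by rewrite order_stat_increasing_order (nth_map (Ordinal j_lt)).
Qed.

Definition gibbs N (sigma : 'I_(2 ^ N) -> config N) (beta : R)
    (x : 'I_(2 ^ N) -> R) (Psi : config N -> R) : R :=
  (\sum_(i < 2 ^ N) Psi (sigma i) * expR (- (beta * Num.sqrt N%:R * x i))) /
  (\sum_(i < 2 ^ N) expR (- (beta * Num.sqrt N%:R * x i))).

Definition gap_weight N (beta : R) (x : 'I_(2 ^ N) -> R) (i : nat) : R :=
  expR (- (beta / beta_c * Num.sqrt (2 * ln (2 ^+ N)) *
           (order_stat x i - order_stat x 1))).

Definition remainder N (sigma : 'I_(2 ^ N) -> config N) (beta : R)
    (x : 'I_(2 ^ N) -> R) (k : nat) (Psi : config N -> R) : R :=
  \sum_(k.+1 <= i < (2 ^ N).+1)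
     Psi (sigma_tilde sigma x i) * gap_weight beta x i.

Definition sup_norm N (Psi : config N -> R) : R :=
  sup (range (fun s => `|Psi s|)).

End REM.
Arguments beta_c {R}.

(* Main.v *)
Require Import Defs.
From mathcomp Require Import all_boot all_order all_algebra.
From mathcomp Require Import all_classical all_reals all_analysis.
From mathcomp Require Import measurable_realfun zify ring lra.
Set Implicit Arguments.
Unset Strict Implicit.
Unset Printing Implicit Defensive.
Import Order.TTheory GRing.Theory Num.Theory.
Import numFieldNormedType.Exports.
Local Open Scope classical_set_scope.
Local Open Scope ring_scope.

(** Put n = 2 ^ N, a = sqrt (2 ln n), b = beta / beta_c > 1 and c = b a, which
    equals beta sqrt N. Around its lower edge - a, a standard Gaussian sample of
    size n looks on the scale 1 / a like a Poisson process whose intensity grows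
    exponentially, so the k-th smallest value lies about (ln k) / a above the
    smallest one. The terms of the partition function, normalised by the
    largest, therefore decay like i ^ (- b), which is summable, and the tail
    beyond k is of order k ^ (1 - b). The bound to be proved is only
    k ^ (- (b - 1) / 2); the spare factor k ^ (- (b - 1) / 2) pays for the
    fluctuation of the smallest value and for all constants, provided k grows
    at least like N, hence like a ^ 2.

    The representation of the Gibbs measure is an identity: sort the terms and
    divide by the largest one ([gibbs_order_stat]). For the remainder, choose
    two levels - s1 < - s2 and consider the event that
    - some X_i is at most - s1, and
    - the sum over i of min (1, exp (- c (X_i + s2))) is less than k.
    The second condition does two things at once. Every X_i below - s2
    contributes 1, so fewer than k values lie below - s2 and every order
    statistic from the k-th on is at least - s2; and the values above - s2
    contribute exactly their Boltzmann weight relative to the level - s2. Hence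
    the remainder is at most k exp (- c (s1 - s2)) times the norm of Psi
    ([sum_gap_le]).

    The failure probability of the first condition is (1 - p) ^ n, with p the
    Gaussian mass below - s1. For the second one the summands take values in
    [0, 1] and are independent, so an exponential Chernoff bound applies
    ([chernoff_independent]); a second-moment bound would only give a failure
    probability of order 1 / k, which is too weak for large delta. With
    s1 = a - (1 + eps) (ln a) / a and s2 = a - ln (k a / (4 K)) / a the expected
    sum is at most k / 4 and both failure probabilities are smaller than every
    power of N ([extreme_scale_bounds], [large_N_bounds]). The choice
    eps = (b - 1) / (2 b) makes the error k exp (- c (s1 - s2)) equal to a
    constant times k ^ (1 - b) a ^ ((b - 1) / 2), and a / k tends to 0. *)

(** * Integration against a weighted image measure *)

Section weighted_pushforward.
Context d d' (T : measurableType d) (U : measurableType d') (R : realType).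
Variables (mu : {measure set T -> \bar R}) (nu : {measure set U -> \bar R}).
Variables (h : T -> R) (Y : T -> U) (c : R).
Hypotheses (mh : measurable_fun setT h) (h0 : forall t, 0 <= h t).
Hypotheses (mY : measurable_fun setT Y) (c0 : 0 <= c).
Hypothesis hY : forall A : set U, measurable A ->
  (\int[mu]_t (h t * \1_A (Y t))%:E = c%:E * nu A)%E.

Import HBNNSimple.

Let mhf (g : U -> R) : measurable_fun setT g ->
  measurable_fun setT (EFin \o (fun t => h t * g (Y t))).
Proof.
move=> mg; apply/measurable_EFinP; apply: measurable_funM => //.
exact: measurableT_comp.
Qed.

Let weighted_nnsfun (g : {nnsfun U >-> R}) :
  (\int[mu]_t (h t * g (Y t))%:E = c%:E * \int[nu]_u (g u)%:E)%E.
Proof.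
transitivity (\int[mu]_t \sum_(y \in range g)
   (y%:E * (h t * \1_(g @^-1` [set y]) (Y t))%:E))%E.
  apply: eq_integral => t _; rewrite [in LHS]fimfunE EFinM -fsumEFin//.
  rewrite ge0_mule_fsumr; last by move=> y; rewrite EFinM nnfun_muleindic_ge0.
  by apply: eq_fsbigr => y _; rewrite -!EFinM; congr (_%:E); rewrite mulrCA.
rewrite ge0_integral_fsum//; last 2 first.
- move=> y; apply: emeasurable_funM => //; apply: mhf.
  exact: measurable_indic.
- move=> y t _; rewrite -EFinM mulrCA EFinM mule_ge0 ?lee_fin//.
  by rewrite -lee_fin EFinM; exact: nnfun_muleindic_ge0.
transitivity (\sum_(y \in range g) c%:E * (y%:E * nu (g @^-1` [set y])))%E.
  apply: eq_fsbigr => y /[!inE] -[u _ <-].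
  rewrite ge0_integralZl//; last 3 first.
  - by apply: mhf; exact: measurable_indic.
  - by move=> t _; rewrite lee_fin mulr_ge0.
  - by rewrite lee_fin.
  by rewrite hY// muleCA.
rewrite -ge0_mule_fsumr; last by move=> y; exact: nnsfun_mulemu_ge0.
by rewrite integralT_nnsfun sintegralE.
Qed.

(** An integral identity known for indicators extends to nonnegative functions
    through the increasing approximation by simple functions. It is used with
    Y the identity and h a density, and with h the product of the remaining
    factors in a product of independent variables. *)
Lemma ge0_integral_weighted_comp (f : U -> R) :
  measurable_fun setT f -> (forall u, 0 <= f u) ->
  (\int[mu]_t (h t * f (Y t))%:E = c%:E * \int[nu]_u (f u)%:E)%E.
Proof.
move=> mf f0.
have mf' : measurable_fun setT (EFin \o f) by exact/measurable_EFinP.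
pose g := nnsfun_approx measurableT mf'.
have g_cvg u : (g n u)%:E @[n --> \oo] --> (f u)%:E.
  by apply: (cvg_nnsfun_approx measurableT mf') => // x _; rewrite lee_fin.
have g_nd u m n : (m <= n)%N -> g m u <= g n u.
  by move=> mn; exact/lefP/nd_nnsfun_approx.
transitivity (limn (fun n => \int[mu]_t (h t * g n (Y t))%:E)%E).
  rewrite -monotone_convergence//=.
  - apply: eq_integral => t _; apply/esym/cvg_lim => //.
    under eq_fun do rewrite EFinM.
    by rewrite EFinM; apply: cvgeZl => //; exact: g_cvg.
  - by move=> n; apply: mhf.
  - by move=> n t _; rewrite lee_fin mulr_ge0.
  - by move=> t _ m n mn; rewrite lee_fin ler_wpM2l// g_nd.
transitivity (c%:E * limn (fun n => \int[nu]_u (g n u)%:E))%E; last first.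
  rewrite -monotone_convergence//=.
  - by congr (_ * _)%E; apply: eq_integral => u _; apply/cvg_lim => //; exact: g_cvg.
  - by move=> n; exact/measurable_EFinP.
  - by move=> n u _; rewrite lee_fin.
  - by move=> u _ m n mn; rewrite lee_fin g_nd.
rewrite -limeMl//; last first.
  apply/ereal_nondecreasing_is_cvgn => m n mn; apply: ge0_le_integral => //=.
  - by move=> u _; rewrite lee_fin.
  - exact/measurable_EFinP.
  - exact/measurable_EFinP.
  - by move=> u _; rewrite lee_fin g_nd.
by apply: congr_lim; apply/funext => n; exact: weighted_nnsfun.
Qed.

End weighted_pushforward.

(** * Products of functions of independent random variables *)

Section independence.
Context d (T : measurableType d) (R : realType) (P : probability T R).
Context (I : finType) (X : I -> {RV P >-> R}).
Hypothesis X_indep : independent_RVs X.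

(** The factors are freed one by one: [s] lists the indices whose factor is
    arbitrary, the others carry an indicator. When [s] is empty this is the
    definition of independence; releasing the index [i] amounts to extending the
    identity from indicators to [g i] with the other factors as a weight. *)
Let expectation_prod_indicators (s : seq I) (g : I -> R -> R) :
  (forall i, measurable_fun setT (g i)) -> (forall i x, 0 <= g i x) ->
  (forall i, \int[P]_t (g i (X i t))%:E < +oo)%E ->
  (forall i, i \notin s -> exists2 A, measurable A & g i = \1_A) ->
  (\int[P]_t (\prod_i g i (X i t))%:E = \prod_i \int[P]_t (g i (X i t))%:E)%E.
Proof.
have mX i A : measurable A -> measurable (X i @^-1` A).
  by move=> mA; rewrite -[_ @^-1` _]setTI; exact: measurable_funP.
have EX i A : measurable A -> (\int[P]_t (\1_A (X i t))%:E = P (X i @^-1` A))%E.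
  move=> mA; rewrite -[in RHS](setIT (X i @^-1` A)) -integral_indic//.
  exact: mX.
elim: s g => [|i s IH] g mg g0 gy gs.
  have {}gs i : exists A, measurable A /\ g i = \1_A.
    by have [A ? ?] := gs i isT; exists A.
  have [A /all_and2[mA gA]] := choice gs.
  have /(_ [set: I]%SET A mA) := X_indep; under eq_bigl do rewrite inE.
  rewrite (_ : [set` [set: I]%SET] = [set: I]); last first.
    by apply/seteqP; split => x //= _; rewrite inE.
  move=> PA.
  under [RHS]eq_bigr do rewrite gA EX//.
  rewrite -PA -[X in P X]setIT -integral_indic//; last first.
    by apply: fin_bigcap_measurable => // i _; exact: mX.
  apply: eq_integral => t _; congr (_%:E).
  under eq_bigr do rewrite gA indicE.
  rewrite indicE; have [|] := boolP (t \in _).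
    rewrite inE => At; rewrite big1// => i _; rewrite mem_set//; exact: At.
  move=> /negP At; have [i iA] : exists i, X i t \notin A i.
    apply: contrapT => /forallNP AX; apply: At; rewrite inE => i _.
    by have /negP := AX i; rewrite negbK inE.
  by rewrite (bigD1 i)//= (negbTE iA) mul0r.
pose h t := \prod_(j | j != i) g j (X j t).
have mh : measurable_fun setT h.
  rewrite /h; under eq_fun do rewrite -big_filter.
  by apply: measurable_prod => j _; exact: measurableT_comp.
have gfin j : (\int[P]_t (g j (X j t))%:E)%E \is a fin_num.
  by rewrite ge0_fin_numE// integral_ge0// => t _; rewrite lee_fin.
(* Finiteness of the expectations makes the constant of the weight real. *)
pose c := \prod_(j | j != i) fine (\int[P]_t (g j (X j t))%:E).
have c0 : 0 <= c.
  by apply: prodr_ge0 => j _; rewrite fine_ge0// integral_ge0// => t _; rewrite lee_fin.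
have cE : c%:E = (\prod_(j | j != i) \int[P]_t (g j (X j t))%:E)%E.
  by rewrite -prodEFin; apply: eq_bigr => j _; rewrite fineK.
under eq_integral do rewrite (bigD1 i)//= mulrC -/(h _).
rewrite [RHS](bigD1 i)//= -cE [RHS]muleC.
rewrite (@ge0_integral_weighted_comp _ _ _ _ _ _ (distribution P (X i)) h (X i) c)//.
- by rewrite ge0_integral_distribution//=; [exact/measurable_EFinP|move=> y; rewrite lee_fin].
- by move=> t; apply: prodr_ge0.
move=> A mA; pose g' j := if j == i then \1_A else g j.
have g'i : g' i = \1_A by rewrite /g' eqxx.
have g'j j : j != i -> g' j = g j by rewrite /g' => /negbTE ->.
have /IH : forall j, measurable_fun setT (g' j).
  by rewrite /g' => j; case: ifP.
have h1 j x : 0 <= g' j x by rewrite /g'; case: ifP.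
have h2 j : (\int[P]_t (g' j (X j t))%:E < +oo)%E.
  rewrite /g'; case: ifPn => // /eqP ->; rewrite EX//.
  by rewrite (le_lt_trans (probability_le1 _ (mX _ _ mA))) ?ltry.
move=> /(_ h1 h2) /= IHg'.
transitivity (\int[P]_t (\prod_j g' j (X j t))%:E)%E.
  apply: eq_integral => t _; rewrite (bigD1 i)//= mulrC g'i; congr (_ * _)%:E.
  by apply: eq_bigr => j ji; rewrite g'j.
rewrite IHg'.
  rewrite (bigD1 i)//= g'i EX// muleC cE; congr (_ * _)%E.
  by apply: eq_bigr => j ji; rewrite g'j.
move=> j js; rewrite /g'; case: ifPn => [_|ji]; first by exists A.
by apply: gs; rewrite inE negb_or ji.
Qed.

Lemma expectation_prod_independent (g : I -> R -> R) :
  (forall i, measurable_fun setT (g i)) -> (forall i x, 0 <= g i x) ->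
  (forall i, \int[P]_t (g i (X i t))%:E < +oo)%E ->
  (\int[P]_t (\prod_i g i (X i t))%:E = \prod_i \int[P]_t (g i (X i t))%:E)%E.
Proof.
move=> mg g0 gy; apply: (expectation_prod_indicators (s := enum I)) => // i.
by rewrite mem_enum inE.
Qed.

End independence.

(** * Gaussian estimates *)

Section gaussian.
Variable R : realType.
Implicit Types r s c x a : R.
Local Notation mu := (@lebesgue_measure R).
Local Notation phi := (normal_pdf (0 : R) 1).

Lemma normal_pdf01E x : phi x = normal_peak 1 * expR (- (x ^+ 2 / 2)).
Proof. by rewrite normal_pdfE ?oner_neq0// /normal_fun subr0 expr1n mulNr. Qed.

Lemma integral_expR_decay r a : 0 < r ->
  (\int[mu]_(x in `[a, +oo[) (expR (- (r * (x - a))))%:E = (r^-1)%:E)%E.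
Proof.
move=> r0.
have dF x : is_derive x 1 (fun x => - (r^-1 * expR (- (r * (x - a))))) (expR (- (r * (x - a)))).
  apply: is_derive_eq; rewrite /GRing.scale/=.
  by field; rewrite gt_eqF.
have cexp : continuous (fun x => expR (- (r * (x - a)))).
  move=> x; apply: continuous_comp; last exact: continuous_expR.
  apply: continuousN; apply: continuousM; first exact: cst_continuous.
  by apply: continuousB => //; exact: cst_continuous.
have exp0 : expR (- (r * (x - a))) @[x --> +oo] --> 0.
  apply: (cvg_comp (fun x => r * (x - a)) (fun x => expR (- x)) _ (@cvgr_expR R)).
  by apply: gt0_cvgMry => //; exact: cvg_addrr.
rewrite (@ge0_continuous_FTC2y _ _ (fun x => - (r^-1 * expR (- (r * (x - a))))) _ 0)//.
- by rewrite subrr mulr0 oppr0 expR0 mulr1 EFinN oppeK add0e.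
- by apply: continuous_subspaceT; exact: cexp.
- rewrite -[X in _ --> X]oppr0 -[X in _ --> - X](mulr0 r^-1).
  by apply: cvgN; apply: cvgM => //; exact: cvg_cst.
- apply: cvgN; apply: cvgM; first exact: cvg_cst.
  by apply: cvg_at_right_filter; exact: cexp.
- by move=> x _; rewrite derive1E derive_val.
Qed.

(** The density is at least [phi (s + r)] on an interval of length [r] ending at
    [- s]. With [r] of order [1 / s] this has the order of the Mills ratio. *)
Lemma normal_left_tail_ge s r : 0 <= s -> 0 < r ->
  ((r * phi (s + r))%:E <= normal_prob (0 : R) 1 `]-oo, (- s)%R])%E.
Proof.
move=> s0 r0.
apply: (@le_trans _ _ (\int[mu]_(x in `[(- s - r)%R, (- s)%R]) (phi x)%:E)%E); last first.
  apply: ge0_subset_integral => //=.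
  - by apply/measurable_EFinP; apply: measurable_funTS; exact: measurable_normal_pdf.
  - by move=> x _; rewrite lee_fin normal_pdf_ge0.
  - by move=> x /=; rewrite !in_itv/= => /andP[].
apply: (@le_trans _ _ (\int[mu]_(x in `[(- s - r)%R, (- s)%R]) (phi (s + r))%:E)%E).
  rewrite integral_cst//= lebesgue_measure_itv/= lte_fin ltrBlDr ltrDl r0.
  by rewrite -EFinB -EFinM lee_fin opprB addrCA subrr addr0 mulrC.
apply: ge0_le_integral => //=.
- by move=> x _; rewrite lee_fin normal_pdf_ge0.
- by apply/measurable_EFinP; apply: measurable_funTS; exact: measurable_normal_pdf.
move=> x; rewrite in_itv/= lee_fin => /andP[sx xs].
rewrite !normal_pdf01E ler_wpM2l ?normal_peak_ge0// ler_expR lerN2.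
have : 0 <= (s + r - x) * (s + r + x) by apply: mulr_ge0; lra.
lra.
Qed.

(** The Boltzmann weight at inverse temperature [c] relative to the level [- s],
    capped at 1 so that it also counts the values below that level. *)
Definition capped_expR c s x := Num.min 1 (expR (- (c * (x + s)))).

Lemma measurable_capped_expR c s : measurable_fun setT (capped_expR c s).
Proof.
apply: measurable_minr => //; apply: measurableT_comp => //.
by apply: measurableT_comp => //; apply: measurable_funM => //; exact: measurable_funD.
Qed.

Lemma capped_expR_ge0 c s x : 0 <= capped_expR c s x.
Proof. by rewrite le_min ler01 expR_ge0. Qed.

Lemma capped_expR_le1 c s x : capped_expR c s x <= 1.
Proof. by rewrite ge_min lexx. Qed.

(** Only the values of [nu] on measurable sets are prescribed, so that the lemma
    applies directly to the law of a random variable. *)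
Lemma integral_gaussian (nu : {measure set R -> \bar R}) (f : R -> R) :
  (forall A, measurable A -> nu A = normal_prob 0 1 A) ->
  measurable_fun setT f -> (forall x, 0 <= f x) ->
  (\int[nu]_x (f x)%:E = \int[mu]_x (phi x * f x)%:E)%E.
Proof.
move=> nuE mf f0; rewrite -[LHS]mul1e.
rewrite (@ge0_integral_weighted_comp _ _ _ _ _ mu nu phi idfun 1)//.
- exact: measurable_normal_pdf.
- exact: normal_pdf_ge0.
- exact: measurable_id.
move=> A mA; rewrite mul1e nuE// /normal_prob [RHS]integral_mkcond.
by apply: eq_integral => x _; rewrite epatch_indic EFinM.
Qed.

(** Completing the square at [- s], the product of the density and the capped
    weight is below [phi s] times [exp (s (x + s))] on the left of [- s] and
    times [exp (- (c - s) (x + s))] on the right: two exponentials, whose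
    integrals are [1 / s] and [1 / (c - s)]. These denominators are needed:
    dropping them would lose a power of [a], which is not affordable when [b]
    is close to 1. *)
Lemma gaussian_capped_expR_le (nu : {measure set R -> \bar R}) s c :
  (forall A, measurable A -> nu A = normal_prob 0 1 A) -> 0 < s -> s < c ->
  (\int[nu]_x (capped_expR c s x)%:E <=
   (phi s * (s^-1 + (c - s)^-1))%:E)%E.
Proof.
move=> nuE s0 sc.
rewrite integral_gaussian//; [|exact: measurable_capped_expR|exact: capped_expR_ge0].
pose g1 x := expR (s * (x + s)); pose g2 x := expR (- ((c - s) * (x - - s))).
have mg1 : measurable_fun setT g1.
  by apply: measurableT_comp => //; apply: measurable_funM => //; exact: measurable_funD.
have mg2 : measurable_fun setT g2.
  apply: measurableT_comp => //; apply: measurableT_comp => //.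
  by apply: measurable_funM => //; exact: measurable_funB.
have I1 : (\int[mu]_(x in `]-oo, (- s)%R]) (g1 x)%:E = (s^-1)%:E)%E.
  rewrite ge0_integration_by_substitutionNy.
  - rewrite -(integral_expR_decay s s0); apply: eq_integral => x _.
    by rewrite /g1/=; congr ((expR _)%:E); ring.
  - apply: continuous_subspaceT => x; apply: continuous_comp; last exact: continuous_expR.
    apply: continuousM; first exact: cst_continuous.
    by apply: continuousD => //; exact: cst_continuous.
  - by move=> x _; exact: expR_ge0.
have I2 : (\int[mu]_(x in `[(- s)%R, +oo[) (g2 x)%:E = ((c - s)^-1)%:E)%E.
  by rewrite integral_expR_decay// subr_gt0.
rewrite EFinM EFinD -I1 -I2 [X in (X + _)%E]integral_mkcond [X in (_ + X)%E]integral_mkcond.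
have mE (A : set R) (g : R -> R) : measurable A -> measurable_fun setT g ->
    measurable_fun setT ((EFin \o g) \_ A).
  move=> mA mg; apply/(measurable_restrictT _ _).1 => //.
  by apply/measurable_EFinP; exact: measurable_funTS.
rewrite -ge0_integralD//=; last 4 first.
- by move=> x _; apply: erestrict_ge0 => y _; rewrite lee_fin expR_ge0.
- exact: mE.
- by move=> x _; apply: erestrict_ge0 => y _; rewrite lee_fin expR_ge0.
- exact: mE.
rewrite -ge0_integralZl//=; last 3 first.
- by apply: emeasurable_funD; exact: mE.
- by move=> x _; rewrite adde_ge0//; apply: erestrict_ge0 => y _; rewrite lee_fin expR_ge0.
- by rewrite lee_fin normal_pdf_ge0.
apply: ge0_le_integral => //=.
- by move=> x _; rewrite lee_fin mulr_ge0 ?normal_pdf_ge0 ?capped_expR_ge0.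
- apply/measurable_EFinP; apply: measurable_funM; first exact: measurable_normal_pdf.
  exact: measurable_capped_expR.
- by apply: measurable_funeM; apply: emeasurable_funD; exact: mE.
move=> x _; rewrite !patchE.
have [xs|sx] := leP x (- s).
  rewrite mem_set/= ?in_itv//=.
  apply: (@le_trans _ _ ((phi s)%:E * (g1 x)%:E)%E); last first.
    rewrite lee_pmul// ?lee_fin ?normal_pdf_ge0 ?expR_ge0//.
    by rewrite leeDl//; case: ifP => // _; rewrite lee_fin expR_ge0.
  rewrite -EFinM lee_fin (@le_trans _ _ (phi x))//.
    by rewrite ler_piMr ?normal_pdf_ge0 ?capped_expR_le1.
  rewrite !normal_pdf01E -[leRHS]mulrA ler_wpM2l ?normal_peak_ge0// -expRD ler_expR.
  have := sqr_ge0 (x + s); nra.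
rewrite memNset/= ?in_itv/=; last by rewrite leNgt sx.
rewrite mem_set/= ?in_itv/= ?andbT ?(ltW sx)// add0e -EFinM lee_fin.
apply: (@le_trans _ _ (phi x * expR (- (c * (x + s))))).
  by rewrite ler_wpM2l ?normal_pdf_ge0// ge_min lexx orbT.
rewrite !normal_pdf01E -[leLHS]mulrA -[leRHS]mulrA ler_wpM2l ?normal_peak_ge0// -!expRD ler_expR.
have := sqr_ge0 (x + s); nra.
Qed.

End gaussian.

(** * Deviation bounds for independent variables *)

(** Follows from [(1 + z) exp (- z / 2) >= (1 + z) (1 - z / 2) >= 1]. *)
Lemma expR_half_le (R : realType) (z : R) : 0 <= z <= 1 -> expR (z / 2) <= 1 + z.
Proof.
move=> /andP[z0 z1].
have e0 : 0 < expR (- (z / 2)) by exact: expR_gt0.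
have e1 := expR_ge1Dx (- (z / 2)).
rewrite -[z / 2]opprK expRN -[leLHS]mul1r ler_pdivrMr//; nra.
Qed.

Section independent_sums.
Context d (T : measurableType d) (R : realType) (P : probability T R).
Context (I : finType) (X : I -> {RV P >-> R}).
Hypothesis X_indep : independent_RVs X.

(** Chernoff's argument with the product of the [1 + f_i] in place of the
    exponential of the sum: it dominates [exp (S / 2)], and its expectation, a
    product by independence, is at most [exp m]. *)
Lemma chernoff_independent (f : I -> R -> R) (m k : R) :
  (forall i, measurable_fun setT (f i)) -> (forall i x, 0 <= f i x <= 1) ->
  (\sum_i \int[P]_t (f i (X i t))%:E <= m%:E)%E ->
  (P [set t | (k <= \sum_i f i (X i t))%R] <= (expR (m - k / 2))%:E)%E.
Proof.
move=> mf f01 fm.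
have f0 i x : 0 <= f i x by case/andP: (f01 i x).
have f1 i x : f i x <= 1 by case/andP: (f01 i x).
have mfX i : measurable_fun setT (fun t => f i (X i t)) by exact: measurableT_comp.
pose S t := \sum_i f i (X i t); pose E := [set t | k <= S t].
have mS : measurable_fun setT S by exact: measurable_sum.
have mE : measurable E.
  by rewrite -[E]setTI; apply: measurable_fun_le => //; exact: measurable_cst.
pose e i := fine (\int[P]_t (f i (X i t))%:E)%E.
have eE i : (\int[P]_t (f i (X i t))%:E)%E = (e i)%:E.
  rewrite /e fineK// ge0_fin_numE ?integral_ge0//; last by move=> t _; rewrite lee_fin.
  apply: (@le_lt_trans _ _ (\int[P]_t 1%:E)%E).
    apply: ge0_le_integral => //=.
    - by move=> t _; rewrite lee_fin.
    - exact/measurable_EFinP.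
    - by move=> t _; rewrite lee_fin.
  by rewrite integral_cst//= probability_setT mule1 ltry.
have e0 i : 0 <= e i.
  by rewrite -lee_fin -eE integral_ge0// => t _; rewrite lee_fin.
have e1 i : (\int[P]_t (1 + f i (X i t))%:E)%E = (1 + e i)%:E.
  under eq_integral do rewrite EFinD.
  rewrite ge0_integralD//=.
  - by rewrite integral_cst//= probability_setT mule1 eE.
  - by move=> t _; rewrite lee_fin.
  - exact/measurable_EFinP.
have main : ((expR (k / 2))%:E * P E <= (expR m)%:E)%E.
  rewrite -[E]setIT -integral_indic// -ge0_integralZl//=; last first.
  - by apply/measurable_EFinP; exact: measurable_indic.
  apply: (@le_trans _ _ (\int[P]_t (\prod_i (1 + f i (X i t)))%:E)%E).
    apply: ge0_le_integral => //=.
    - by apply: measurable_funeM; apply/measurable_EFinP; exact: measurable_indic.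
    - apply/measurable_EFinP; apply: measurable_prod => i _.
      exact: measurable_funD.
    move=> t _; rewrite -EFinM lee_fin.
    have p0 : 0 <= \prod_i (1 + f i (X i t)).
      by apply: prodr_ge0 => i _; rewrite addr_ge0.
    rewrite indicE; have [|_] := boolP (t \in E); last by rewrite mulr0.
    rewrite inE /E/= mulr1 => kS; apply: (@le_trans _ _ (expR (S t / 2))).
      by rewrite ler_expR ler_wpM2r// invr_ge0.
    rewrite /S mulr_suml expR_sum; apply: ler_prod => i _.
    by rewrite expR_ge0 expR_half_le.
  rewrite (@expectation_prod_independent _ _ _ _ _ _ X_indep (fun i x => 1 + f i x)).
  - under eq_bigr do rewrite e1.
    rewrite prodEFin lee_fin (@le_trans _ _ (expR (\sum_i e i)))//.
      rewrite expR_sum; apply: ler_prod => i _.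
      by rewrite addr_ge0//= expR_ge1Dx.
    by rewrite ler_expR -lee_fin -sumEFin (le_trans _ fm)// lee_sum// => i _; rewrite eE.
  - by move=> i; exact: measurable_funD.
  - by move=> i x; rewrite addr_ge0.
  - by move=> i; rewrite e1 ltry.
rewrite -(@lee_pmul2l _ (expR (k / 2))%:E)//; last by rewrite lte_fin expR_gt0.
by rewrite (le_trans main)// -EFinM -expRD lee_fin; rewrite ler_expR; lra.
Qed.

Lemma independent_no_small_value (p s : R) :
  (forall i, (p%:E <= P (X i @^-1` `]-oo, s%R]))%E) ->
  (P (\bigcap_i (X i @^-1` `]s%R, +oo[)) <= (expR (- (#|I|%:R * p)))%:E)%E.
Proof.
move=> pP.
have /(_ [set: I]%SET (fun=> `]s%R, +oo[%classic)) := X_indep.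
under eq_bigl do rewrite inE.
rewrite (_ : [set` [set: I]%SET] = [set: I]); last first.
  by apply/seteqP; split => x //= _; rewrite inE.
move=> -> //.
have mX i : measurable (X i @^-1` `]-oo, s%R]).
  by rewrite -[_ @^-1` _]setTI; exact: measurable_funP.
have XE i : P (X i @^-1` `]s%R, +oo[) = (1 - P (X i @^-1` `]-oo, s%R]))%E.
  rewrite -probability_setC//; congr (P _).
  by rewrite preimage_setC; congr (_ @^-1` _); rewrite setCitvl.
have PXE i : P (X i @^-1` `]-oo, s%R]) = (fine (P (X i @^-1` `]-oo, s%R])))%:E.
  by rewrite fineK// fin_num_measure.
under eq_bigr do rewrite XE PXE -EFinB.
rewrite prodEFin lee_fin -mulrN.
rewrite mulr_natl -sumr_const expR_sum; apply: ler_prod => i _.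
have := probability_le1 P (mX i); have := pP i; rewrite PXE !lee_fin => pi i1.
by rewrite subr_ge0 i1 (le_trans _ (expR_ge1Dx _))// lerD2l lerN2.
Qed.

End independent_sums.

(** * Order statistics and the Gibbs measure *)

Section order_statistics.
Variables (R : realType) (n : nat) (x : 'I_n -> R).

Lemma size_increasing_order : size (increasing_order x) = n.
Proof. by rewrite size_sort size_enum_ord. Qed.

Lemma sum_order_stat (F : R -> R) :
  \sum_(1 <= i < n.+1) F (order_stat x i) = \sum_i F (x i).
Proof.
rewrite big_add1/= /order_stat.
set s := sort _ _.
have -> : \sum_(0 <= i < n) F (nth 0 s i.+1.-1) = \sum_(y <- s) F y.
  by rewrite [RHS](big_nth 0) /s size_sort size_map size_enum_ord.
rewrite (perm_big [seq x i | i <- enum 'I_n]) ?perm_sort// big_map.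
by rewrite big_enum.
Qed.

Lemma order_stat_le (i j : nat) : (i <= j <= n)%N -> (0 < j)%N ->
  order_stat x i <= order_stat x j.
Proof.
move=> /andP[ij jn] j0; apply: (sorted_leq_nth le_trans lexx).
- exact: (sort_sorted (@le_total _ _)).
- by rewrite inE size_sort size_map size_enum_ord; lia.
- by rewrite inE size_sort size_map size_enum_ord; lia.
- by lia.
Qed.

Lemma order_stat1_le (i : 'I_n) : order_stat x 1 <= x i.
Proof.
have : x i \in sort <=%O [seq x i | i <- enum 'I_n].
  by rewrite mem_sort map_f// mem_enum.
move=> /(nthP 0) [j]; rewrite size_sort size_map size_enum_ord => jn <-.
by apply: (@order_stat_le 1 j.+1).
Qed.

(** If the [j]-th order statistic were below [- s], the [j] smallest values would
    each contribute 1 to the capped sum. *)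
Lemma order_stat_ge_of_count (c s : R) (k j : nat) : 0 <= c ->
  \sum_i capped_expR c s (x i) < k%:R -> (k <= j <= n)%N ->
  - s <= order_stat x j.
Proof.
move=> c0 Sk /andP[kj jn]; rewrite leNgt; apply/negP => js.
suff : k%:R <= \sum_i capped_expR c s (x i) by rewrite leNgt Sk.
apply: (@le_trans _ _ j%:R); first by rewrite ler_nat.
rewrite -sum_order_stat (@big_cat_nat _ _ _ j.+1)//=.
rewrite -[leLHS]addr0 lerD//; last first.
  by apply: sumr_ge0 => i _; exact: capped_expR_ge0.
rewrite -[j in leLHS]subn0 -subSS -[leLHS]mulr1 mulr_natl -sumr_const_nat.
apply: ler_sum_nat => i /andP[i0 ij].
rewrite le_min lexx/= -expR0 ler_expR oppr_ge0.
rewrite mulr_ge0_le0//.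
have : order_stat x i <= order_stat x j by apply: order_stat_le; lia.
by lra.
Qed.

(** Beyond the rank [k] all values exceed [- s2], so the cap is inactive there and
    moving the reference level from the minimum to [- s2] costs at most the
    factor [exp (- c (s1 - s2))]. *)
Lemma sum_gap_le (c s1 s2 : R) (k : nat) (i0 : 'I_n) : 0 <= c ->
  x i0 <= - s1 -> \sum_i capped_expR c s2 (x i) < k%:R -> (k <= n)%N ->
  \sum_(k.+1 <= i < n.+1) expR (- (c * (order_stat x i - order_stat x 1))) <=
    k%:R * expR (- (c * (s1 - s2))).
Proof.
move=> c0 xs1 Sk kn.
apply: (@le_trans _ _ (\sum_(k.+1 <= i < n.+1)
    capped_expR c s2 (order_stat x i) * expR (- (c * (s1 - s2))))).
  apply: ler_sum_nat => i /andP[ki iN].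
  have si : - s2 <= order_stat x i.
    by apply: (order_stat_ge_of_count c0 Sk); lia.
  rewrite /capped_expR min_r; last first.
    by rewrite -expR0 ler_expR oppr_le0 mulr_ge0//; lra.
  rewrite -expRD ler_expR.
  have : order_stat x 1 <= - s1 := le_trans (order_stat1_le i0) xs1.
  by nra.
rewrite -mulr_suml ler_wpM2r ?expR_ge0//.
apply: (le_trans _ (ltW Sk)).
rewrite -sum_order_stat [leRHS](@big_cat_nat _ _ _ k.+1)//= lerDr.
by apply: sumr_ge0 => i _; exact: capped_expR_ge0.
Qed.

End order_statistics.

Section gibbs_by_order_statistics.
Variables (R : realType) (N : nat).
Variables (sigma : 'I_(2 ^ N) -> config N) (beta : R) (x : 'I_(2 ^ N) -> R).

Lemma norm_le_sup_norm (Psi : config N -> R) (s : config N) :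
  `|Psi s| <= sup_norm Psi.
Proof.
apply: ub_le_sup; last by exists s.
exists (\sum_(t : {ffun 'I_N -> seq_sub [:: -1; 1 : int]}) `|Psi t|) => _ [t _ <-].
by rewrite (bigD1 t)//= lerDl sumr_ge0.
Qed.

Lemma sum_sigma_tilde (F : config N -> R -> R) :
  \sum_(1 <= i < (2 ^ N).+1) F (sigma_tilde sigma x i) (order_stat x i) =
  \sum_i F (sigma i) (x i).
Proof.
rewrite big_add1/=.
have -> : \sum_(0 <= i < 2 ^ N) F (sigma_tilde sigma x i.+1) (order_stat x i.+1) =
    \sum_(i <- increasing_order x) F (sigma i) (x i).
  have n0 : (0 < 2 ^ N)%N by rewrite expn_gt0.
  rewrite [RHS](big_nth (Ordinal n0)) size_increasing_order.
  apply: eq_big_nat => i /andP[_ iN].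
  rewrite order_stat_increasing_order /sigma_tilde/=.
  by rewrite !(nth_map (Ordinal n0)) ?size_increasing_order.
by rewrite (perm_big (enum 'I_(2 ^ N))) ?perm_sort// big_enum.
Qed.

(** The two writings of the inverse temperature agree since
    [beta_c * sqrt N = sqrt (2 ln (2 ^ N))]. *)
Lemma inverse_temperature_scaling :
  beta / beta_c * Num.sqrt (2 * ln (2 ^+ N)) = beta * Num.sqrt N%:R.
Proof.
have ln20 : 0 < ln (2 : R) by rewrite ln_gt0// ltr1n.
have -> : 2 * ln (2 ^+ N) = 2 * ln 2 * N%:R :> R.
  by rewrite lnXn// -[in RHS]mulrA mulr_natr.
rewrite sqrtrM ?mulr_ge0 ?ltW// mulrA divfK//.
by rewrite gt_eqF// sqrtr_gt0 mulr_gt0.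
Qed.

(** Numerator and denominator carry the common factor [exp (- c X_1)], the
    largest Boltzmann weight, which cancels. *)
Lemma gibbs_order_stat (Psi : config N -> R) (k : nat) : (k <= 2 ^ N)%N ->
  gibbs sigma beta x Psi =
    (\sum_(1 <= i < k.+1) Psi (sigma_tilde sigma x i) * gap_weight beta x i +
       remainder sigma beta x k Psi) /
    (\sum_(1 <= i < k.+1) gap_weight beta x i +
       remainder sigma beta x k (fun=> 1)).
Proof.
move=> kN; set m := order_stat x 1; set c := beta * Num.sqrt N%:R.
have numE (Phi : config N -> R) :
  \sum_i Phi (sigma i) * expR (- (c * x i)) = expR (- (c * m)) *
    (\sum_(1 <= i < k.+1) Phi (sigma_tilde sigma x i) * gap_weight beta x i +
       remainder sigma beta x k Phi).
  rewrite /remainder -big_cat_nat//=.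
  rewrite -(sum_sigma_tilde (fun s y => Phi s * expR (- (c * y)))) mulr_sumr.
  apply: eq_bigr => i _; rewrite /gap_weight inverse_temperature_scaling -/c -/m.
  by rewrite mulrCA -expRD; congr (_ * expR _); ring.
have denE := numE (fun=> 1).
rewrite /gibbs numE.
under [X in _ / X]eq_bigr do rewrite -[expR _]mul1r.
rewrite denE; under [X in _ / (_ * (X + _))]eq_bigr do rewrite mul1r.
by rewrite -mulf_div divff ?mul1r// gt_eqF ?expR_gt0.
Qed.

Lemma remainder_le (Psi : config N -> R) (k : nat) :
  `|remainder sigma beta x k Psi| <=
  sup_norm Psi * \sum_(k.+1 <= i < (2 ^ N).+1) gap_weight beta x i.
Proof.
rewrite mulr_sumr (le_trans (ler_norm_sum _ _ _))//; apply: ler_sum => i _.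
by rewrite normrM [`|gap_weight _ _ _|]ger0_norm ?expR_ge0// ler_wpM2r ?expR_ge0 ?norm_le_sup_norm.
Qed.

End gibbs_by_order_statistics.

(** * The event controlling the lower extremes of a Gaussian sample *)

Section gaussian_extremes.
Context d (T : measurableType d) (R : realType) (P : probability T R).
Context (I : finType) (X : I -> {RV P >-> R}).
Hypotheses (X_indep : independent_RVs X).
Hypothesis X_gauss : forall i, standard_gaussian (X i).
Local Notation phi := (normal_pdf (0 : R) 1).

(** A union bound over the two ways to fail. The hypothesis on [k / 4] bounds the
    mean of the capped sum, so Chernoff's bound at [k] reads
    [exp (k / 4 - k / 2)]. *)
Lemma gaussian_extremes_event (s1 h c s2 k : R) :
  0 <= s1 -> 0 < h -> 0 < s2 -> s2 < c ->
  #|I|%:R * (phi s2 * (s2^-1 + (c - s2)^-1)) <= k / 4 ->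
  exists E : set T,
    [/\ measurable E,
        ((1 - (expR (- (#|I|%:R * (h * phi (s1 + h)))) + expR (- (k / 4))))%:E <= P E)%E &
        forall w, E w -> (exists i, X i w <= - s1) /\
                         \sum_i capped_expR c s2 (X i w) < k].
Proof.
move=> s10 h0 s20 sc mk.
have mX i A : measurable A -> measurable (X i @^-1` A).
  by move=> mA; rewrite -[_ @^-1` _]setTI; exact: measurable_funP.
pose E1 := \bigcap_i (X i @^-1` `]- s1, +oo[).
pose S w := \sum_i capped_expR c s2 (X i w).
pose E2 := [set w | k <= S w].
have mE1 : measurable E1 by apply: fin_bigcap_measurable => // i _; exact: mX.
have mS : measurable_fun setT S.
  by apply: measurable_sum => i; apply: measurableT_comp => //; exact: measurable_capped_expR.
have mE2 : measurable E2.
  by rewrite -[E2]setTI; apply: measurable_fun_le => //; exact: measurable_cst.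
have PE1 : (P E1 <= (expR (- (#|I|%:R * (h * phi (s1 + h)))))%:E)%E.
  apply: independent_no_small_value => // i.
  by rewrite [leRHS]X_gauss//; exact: normal_left_tail_ge.
have PE2 : (P E2 <= (expR (- (k / 4)))%:E)%E.
  rewrite (_ : - (k / 4) = k / 4 - k / 2); last by field.
  apply: (chernoff_independent X_indep (f := fun=> capped_expR c s2)) => //.
  - by move=> i; exact: measurable_capped_expR.
  - by move=> i x; rewrite capped_expR_ge0 capped_expR_le1.
  apply: (@le_trans _ _ (\sum_(i : I) (phi s2 * (s2^-1 + (c - s2)^-1))%:E)%E).
    apply: lee_sum => i _.
    have <- : (\int[distribution P (X i)]_x (capped_expR c s2 x)%:E =
        \int[P]_w (capped_expR c s2 (X i w))%:E)%E.
      apply: (@ge0_integral_distribution _ _ _ _ _ _ (X i) (EFin \o capped_expR c s2)).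
      - by apply/measurable_EFinP; exact: measurable_capped_expR.
      - by move=> y; rewrite lee_fin capped_expR_ge0.
    exact: (gaussian_capped_expR_le (X_gauss i)).
  by rewrite sumEFin lee_fin sumr_const -[leLHS]mulr_natl.
exists (~` (E1 `|` E2)); split.
- by apply: measurableC; exact: measurableU.
- rewrite probability_setC; last exact: measurableU.
  rewrite EFinB leeB// (le_trans (measureU2 _ _ _))//.
  by rewrite EFinD leeD.
move=> w /not_orP[w1 w2]; split; last by rewrite ltNge; exact/negP.
apply: contrapT => /forallNP wN; apply: w1 => i _ /=.
by rewrite in_itv/= andbT ltNge; exact/negP.
Qed.

End gaussian_extremes.

(** * Choice of the two levels *)

Section extreme_scale.
Variable R : realType.
Local Notation phi := (normal_pdf (0 : R) 1).

(** When the sample size is [exp (a ^ 2 / 2)], its density at distance [y / a]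
    above the edge [- a] is [exp y] up to the peak and a quadratic correction. *)
Lemma normal_pdf_below (a y : R) : 0 < a ->
  expR (a ^+ 2 / 2) * phi (a - y / a) =
  normal_peak 1 * expR (y - (y / a) ^+ 2 / 2).
Proof.
move=> a0; rewrite normal_pdf01E mulrCA -expRD; congr (_ * expR _).
by field; rewrite gt_eqF.
Qed.

Lemma normal_peak1_le1 : normal_peak (1 : R) <= 1.
Proof.
rewrite /normal_peak invf_le1 ?sqrtr_gt0 expr1n mul1r.
  rewrite -[leLHS]sqrtr1 ler_sqrt; have := @pi_ge2 R; lra.
by have := @pi_gt0 R; lra.
Qed.

(** Bound for [a (1 / s2 + 1 / (b a - s2))] when [a / 2 <= s2 <= a]: the factor in
    the mean of the capped sum that comes from the two exponential integrals. *)
Definition extreme_const (b : R) := 2 + (b - 1)^-1.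

(** The levels are written [- (a - y1 / a)] and [- (a - y2 / a)]. About [exp y / a]
    sample points lie below [- (a - y / a)]; thus [y1] slightly above [ln a] makes
    it very likely that the smallest value is below the first level, and
    [exp y2 / a = k / (4 K)] keeps the mean of the capped sum below [k / 4]. The
    last clause is the resulting error in logarithmic form: one power
    [k ^ (- (b - 1) / 2)] is the announced rate, the other one absorbs the
    constant and the power of [a]. *)
Lemma extreme_scale_bounds (a b k : R) :
  let eps := (b - 1) / (2 * b) in
  let K := extreme_const b in
  let y1 := (1 + eps) * ln a in
  let y2 := ln (k * a / (4 * K)) in
  1 < b -> 2 <= a -> 4 * K <= k -> ln k + ln a <= a ^+ 2 / 2 ->
  [/\ 0 <= a - y1 / a,
      0 < a - y2 / a < b * a,
      normal_peak 1 * expR (eps * ln a - 3) <=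
        expR (a ^+ 2 / 2) * (a^-1 * phi (a - y1 / a + a^-1)),
      expR (a ^+ 2 / 2) * (phi (a - y2 / a) *
        ((a - y2 / a)^-1 + (b * a - (a - y2 / a))^-1)) <= k / 4 &
      k * expR (- (b * a * (a - y1 / a - (a - y2 / a)))) =
        expR (b * ln (4 * K) - (b - 1) / 2 * (ln k - ln a) - (b - 1) / 2 * ln k)].
Proof.
move=> eps K y1 y2 b1 a2 Kk ka.
have a0 : 0 < a by lra.
have bV0 : 0 < (b - 1)^-1 by rewrite invr_gt0; lra.
have K2 : 2 < K by rewrite /K /extreme_const; lra.
have k0 : 0 < k by lra.
have u0 : 0 <= ln a by rewrite ln_ge0//; lra.
have eps0 : 0 < eps by rewrite divr_gt0//; lra.
have eps1 : eps <= 1 by rewrite ler_pdivrMr; lra.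
have ua : ln a <= a - 1 by have := @le_ln1Dx R (a - 1); rewrite addrCA subrr addr0; apply; lra.
have y10 : 0 <= y1 by rewrite mulr_ge0//; lra.
have y1a : y1 <= 2 * a by rewrite /y1; nra.
have y2E : y2 = ln k + ln a - ln (4 * K).
  by rewrite /y2 ln_div ?posrE ?mulr_gt0 ?lnM ?posrE//; lra.
have lnK0 : 0 <= ln (4 * K) by rewrite ln_ge0//; lra.
have y20 : 0 <= y2 by rewrite ln_ge0// ler_pdivlMr; nra.
have y2a : y2 / a <= a / 2 by rewrite ler_pdivrMr//; nra.
have y2a0 : 0 <= y2 / a by rewrite divr_ge0// ltW.
have s2 : a / 2 <= a - y2 / a by lra.
have s2b : a - y2 / a < b * a by nra.
split.
- by rewrite subr_ge0 ler_pdivrMr//; nra.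
- by rewrite s2b andbT; lra.
  (* Integrating over a length 1 / a replaces y1 by y1 - 1; the quadratic
     correction ((y1 - 1) / a) ^ 2 / 2 is at most 2, hence the constant 3. *)
- have -> : a - y1 / a + a^-1 = a - (y1 - 1) / a by field; rewrite gt_eqF.
  rewrite mulrCA normal_pdf_below// mulrCA ler_wpM2l ?normal_peak_ge0//.
  rewrite ler_pdivlMl// -{1}(@lnK _ a) ?posrE// -expRD ler_expR.
  have : ((y1 - 1) / a) ^+ 2 <= 4.
    rewrite -[4](_ : 2 ^+ 2 = _); last by ring.
    have : -2 <= (y1 - 1) / a <= 2.
      by rewrite ler_pdivlMr// ler_pdivrMr//; apply/andP; split; lra.
    by nra.
  by rewrite /y1; lra.
- rewrite mulrA normal_pdf_below//.
  have E2 : normal_peak 1 * expR (y2 - (y2 / a) ^+ 2 / 2) <= k * a / (4 * K).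
    rewrite -[leRHS]mul1r ler_pM ?normal_peak_ge0 ?expR_ge0 ?normal_peak1_le1//.
    rewrite -[leRHS]lnK ?posrE ?divr_gt0 ?mulr_gt0//; last by lra.
    by rewrite ler_expR -/y2 gerBl divr_ge0// sqr_ge0.
  have Va : (a - y2 / a)^-1 + (b * a - (a - y2 / a))^-1 <= K / a.
    rewrite /K /extreme_const mulrDl lerD//.
      by rewrite -[leRHS]invf_div lef_pV2 ?posrE//; lra.
    by rewrite -[leRHS]invfM lef_pV2 ?posrE//; nra.
  apply: (le_trans (ler_pM _ _ E2 Va)).
  + by rewrite mulr_ge0 ?normal_peak_ge0 ?expR_ge0.
  + by rewrite addr_ge0// invr_ge0; lra.
  rewrite le_eqVlt; apply/orP; left; apply/eqP; field.
  by rewrite !gt_eqF//; lra.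
rewrite -{1}(@lnK _ k) ?posrE// -expRD; congr expR.
rewrite (_ : b * a * (a - y1 / a - (a - y2 / a)) = b * (y2 - y1)); last first.
  by field; rewrite gt_eqF.
rewrite y2E /y1 /eps; field; rewrite gt_eqF//; lra.
Qed.

End extreme_scale.

(** * Conditions satisfied for large N *)

Section large_N.
Variable R : realType.

Lemma ln2_bounds : 1 / 2 <= ln (2 : R) <= 1.
Proof.
apply/andP; split.
  rewrite -ler_expR lnK ?posrE// (le_trans (@expR_half_le _ 1 _))//; lra.
by have := @le_ln1Dx R 1; rewrite (_ : 1 + 1 = 2 :> R)//; apply; lra.
Qed.

(** Everything follows from [N] large and [k / N] large, apart from
    [k <= 2 ^ N] and [s2 >= a / 2], which need [ln k] to be at most half of
    [ln (2 ^ N)]. Both failure probabilities beat [(ln 2 ^ N) ^ (- (1 + delta))]: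
    the first since [a ^ eps] exceeds every multiple of [ln a], the second since
    [k] exceeds every multiple of [N]. *)
Lemma large_N_bounds (b delta : R) : 1 < b -> 0 < delta ->
  let eps := (b - 1) / (2 * b) in
  let K := extreme_const b in
  exists A C : R, forall (N k : nat), A <= N%:R -> C * N%:R <= k%:R ->
    ln (k%:R : R) <= N%:R * (ln 2 / 2) ->
    let a : R := Num.sqrt (2 * ln (2 ^+ N)) in
    [/\ 2 <= a, expR (a ^+ 2 / 2) = 2 ^+ N, (1 < k <= 2 ^ N)%N, 4 * K <= k%:R &
        ln k%:R + ln a <= a ^+ 2 / 2] /\
    [/\ expR (- (normal_peak 1 * expR (eps * ln a - 3))) <=
          1 / (N%:R * ln 2) `^ (1 + delta),
        expR (- (k%:R / 4)) <= 1 / (N%:R * ln 2) `^ (1 + delta) &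
        b * ln (4 * K) - (b - 1) / 2 * (ln k%:R - ln a) <= ln (2 / (b - 1))].
Proof.
move=> b1 d0 eps K.
have bV0 : 0 < (b - 1)^-1 by rewrite invr_gt0; lra.
have K2 : 2 < K by rewrite /K /extreme_const; lra.
have eps0 : 0 < eps by rewrite divr_gt0//; lra.
have /andP[l1 l2] := ln2_bounds.
pose q := normal_peak (1 : R) * expR (-3).
have q0 : 0 < q by rewrite mulr_gt0 ?expR_gt0// normal_peak_gt0// oner_neq0.
pose U := 4 * (1 + delta) / (q * eps ^+ 2).
pose D := (b * ln (4 * K) - ln (2 / (b - 1))) / ((b - 1) / 2).
(* U is the threshold beyond which q exp (eps u), bounded below by
   q (eps u) ^ 2 / 2, exceeds 2 (1 + delta) u; D is the lower bound on
   ln k - ln a that absorbs the constants of the error. *)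
exists (16 + expR (2 * U)), (4 * K + 2 * expR D + 4 * (1 + delta)).
move=> N k AN Ck lnk a.
have eD0 := expR_gt0 D; have eU0 := expR_gt0 (2 * U).
have N16 : 16 <= N%:R :> R by lra.
have aE : a ^+ 2 = 2 * (N%:R * ln 2).
  have lnN : ln (2 ^+ N) = N%:R * ln 2 :> R by rewrite lnXn// mulr_natl.
  by rewrite /a lnN sqr_sqrtr//; nra.
have a2N : a ^+ 2 <= 2 * N%:R by rewrite aE; nra.
have Na2 : N%:R <= a ^+ 2 by rewrite aE; nra.
have a0 : 0 <= a by exact: sqrtr_ge0.
have a4 : 4 <= a by nra.
have agt0 : 0 < a by lra.
have kgt : 4 * K + 2 * expR D * N%:R + 4 * (1 + delta) * N%:R <= k%:R.
  apply: le_trans Ck; nra.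
have dN0 : 0 <= 4 * (1 + delta) * N%:R by nra.
have DN0 : 0 <= 2 * expR D * N%:R by nra.
have kK : 4 * K <= k%:R by lra.
have k0 : 0 < k%:R :> R by lra.
have k1 : 1 < k%:R :> R by lra.
have eN : expR (a ^+ 2 / 2) = 2 ^+ N.
  rewrite aE (_ : 2 * (N%:R * ln 2) / 2 = N%:R * ln 2); last by field.
  by rewrite expRM_natl lnK// posrE.
pose u := ln a.
have ua : u <= a - 1.
  by have := @le_ln1Dx R (a - 1); rewrite addrCA subrr addr0; apply; lra.
have u0 : 0 <= u by rewrite ln_ge0//; lra.
have uU : U <= u.
  rewrite -ler_expR lnK ?posrE//.
  have : expR U ^+ 2 <= a ^+ 2 by rewrite -expRM_natl; lra.
  by rewrite ler_pXn2r// nnegrE expR_ge0.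
have L0 : 0 < N%:R * ln (2 : R) by nra.
have L1 : 1 <= N%:R * ln (2 : R) by nra.
have lnL : ln (N%:R * ln (2 : R)) <= 2 * u.
  rewrite (_ : 2 * u = ln (a ^+ 2)); last by rewrite lnXn// mulr_natl.
  by rewrite ler_ln ?posrE ?exprn_gt0//; lra.
have lnL0 : 0 <= ln (N%:R * ln (2 : R)) by exact: ln_ge0.
have powE : 1 / (N%:R * ln 2) `^ (1 + delta) = expR (- ((1 + delta) * ln (N%:R * ln 2))).
  by rewrite /powR gt_eqF// expRN div1r.
split; split => //.
- lra.
- rewrite -(ltr_nat R) -(ler_nat R) k1/= natrX -eN aE.
  rewrite -(@lnK _ k%:R) ?posrE// ler_expR; nra.
- rewrite -/u aE; nra.
- rewrite powE ler_expR lerN2.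
  have e2 : (eps * u) ^+ 2 / 2 <= expR (eps * u).
    have eu : 0 <= eps * u by nra.
    have := @expR_ge1Dxn R (eps * u) 1 eu; rewrite (_ : 2`!%:R = 2 :> R)//; lra.
  apply: (@le_trans _ _ ((1 + delta) * (2 * u))); first by rewrite ler_wpM2l//; lra.
  apply: (@le_trans _ _ (q * ((eps * u) ^+ 2 / 2))); last first.
    rewrite expRD [leRHS](_ : _ = q * expR (eps * u)); last by rewrite /q /u; ring.
    by rewrite ler_wpM2l// ltW.
  have : 4 * (1 + delta) <= u * (q * eps ^+ 2).
    by rewrite -ler_pdivrMr// mulr_gt0// exprn_gt0.
  by nra.
- rewrite powE ler_expR lerN2.
  have : ln (N%:R * ln (2 : R)) <= N%:R by have := ln_sublinear L0; nra.
  by nra.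
have Dle : D <= ln k%:R - ln a.
  rewrite -ler_expR -ln_div ?posrE// lnK ?posrE ?divr_gt0// ler_pdivlMr//.
  have : a <= 2 * N%:R by nra.
  by nra.
have : D * ((b - 1) / 2) = b * ln (4 * K) - ln (2 / (b - 1)).
  by rewrite divfK// gt_eqF//; lra.
by nra.
Qed.

End large_N.

(** * The Gibbs measure through its lowest energies *)

Theorem theorem3p1 (R : realType) (d : measure_display) (T : measurableType d)
  (P : probability T R)
  (sigma : forall N : nat, 'I_(2 ^ N) -> config N)
  (sigma_bij : forall N : nat, bijective (sigma N))
  (X : forall N : nat, 'I_(2 ^ N) -> {RV P >-> R})
  (X_indep : forall N : nat, independent_RVs (X N))
  (X_gauss : forall (N : nat) (i : 'I_(2 ^ N)), standard_gaussian (X N i))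
  (beta delta : R) (beta_gt : beta_c < beta) (delta_gt0 : 0 < delta)
  (k : nat -> nat) (k_gt0 : forall N : nat, (0 < k N)%N)
  (k_infty : ((k N)%:R : R) @[N --> \oo] --> +oo)
  (k_div_infty : ((k N)%:R / N%:R : R) @[N --> \oo] --> +oo)
  (log_k_div_0 : (ln (k N)%:R / N%:R : R) @[N --> \oo] --> (0 : R)) :
  exists N0 : nat, forall N : nat, (N0 < N)%N ->
  exists Omega_N : set T,
    [/\ measurable Omega_N,
        ((1 - 4 / (N%:R * ln 2) `^ (1 + delta))%:E <= P Omega_N)%E &
        forall w : T, Omega_N w -> forall Psi : config N -> R,
          let x := fun i : 'I_(2 ^ N) => X N i w in
          let B := remainder (sigma N) beta x (k N) in
          gibbs (sigma N) beta x Psi =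
            (\sum_(1 <= i < (k N).+1)
                Psi (sigma_tilde (sigma N) x i) * gap_weight beta x i + B Psi) /
            (\sum_(1 <= i < (k N).+1) gap_weight beta x i + B (fun=> 1))
          /\ `|B Psi| <= 2 * sup_norm Psi / (beta / beta_c - 1) *
               (1 / ((k N)%:R - 1) `^ ((beta / beta_c - 1) / 2))].
Proof.
have bc0 : 0 < beta_c :> R.
  by rewrite sqrtr_gt0 mulr_gt0// ln_gt0// ltr1n.
set b := beta / beta_c.
have b1 : 1 < b by rewrite /b ltr_pdivlMr// mul1r.
have [A [C bounds]] := large_N_bounds b1 delta_gt0.
have [N1 _ N1P] : \forall N \near \oo, A <= N%:R by exact: nbhs_infty_ger.
have [N2 _ N2P] : \forall N \near \oo, C <= (k N)%:R / N%:R.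
  by move/cvgryPge : k_div_infty; exact.
have [N3 _ N3P] : \forall N \near \oo, ln (k N)%:R / N%:R <= ln 2 / 2 :> R.
  apply: (cvgr_le 0) => //.
  by rewrite divr_gt0// ln_gt0// ltr1n.
exists (N1 + N2 + N3)%N => N N0.
have Npos : 0 < N%:R :> R by rewrite ltr0n; lia.
have [||//|] := bounds N (k N).
- by apply: N1P => /=; lia.
- by rewrite -ler_pdivlMr//; apply: N2P => /=; lia.
- by rewrite mulrC -ler_pdivrMr//; apply: N3P => /=; lia.
set a := Num.sqrt _ => -[a2 aN /andP[k1 kN] kK ka] [p1 p2 Bk].
have [s10 /andP[s20 s2b] tail mean weight] := extreme_scale_bounds b1 a2 kK ka.
set y1 := _ * ln a in s10 tail weight; set y2 := ln (_ / _) in s20 s2b mean weight.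
have a0 : 0 < a by lra.
have card_n : #|'I_(2 ^ N)|%:R = expR (a ^+ 2 / 2) :> R by rewrite card_ord natrX aN.
have aV0 : 0 < a^-1 by rewrite invr_gt0.
rewrite -card_n in mean.
have [E [mE PE EP]] := gaussian_extremes_event (X_indep N) (X_gauss N) s10 aV0 s20 s2b mean.
exists E; split => //.
  apply: le_trans PE; rewrite lee_fin lerD2l lerN2.
  rewrite card_n.
  apply: (@le_trans _ _ (1 / (N%:R * ln 2) `^ (1 + delta) + 1 / (N%:R * ln 2) `^ (1 + delta))).
    rewrite lerD//; apply: le_trans p1.
    by rewrite ler_expR lerN2.
  rewrite -mulrDl ler_wpM2r ?invr_ge0 ?powR_ge0//; lra.
move=> w Ew Psi x B; have [[i0 xi0] S] := EP w Ew.
split; first exact: gibbs_order_stat.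
apply: (le_trans (remainder_le _ _ _ _ _)).
have Psi0 : 0 <= sup_norm Psi.
  exact: le_trans (norm_le_sup_norm Psi (all_plus N)).
rewrite -mulrA -mulrA mulrCA ler_wpM2l//.
apply: (le_trans (sum_gap_le (ltW (mulr_gt0 (lt_trans ltr01 b1) a0)) xi0 S kN)).
rewrite weight expRD.
have k1R : 1 < (k N)%:R :> R by rewrite ltr1n.
have k0R : 0 < (k N)%:R - 1 :> R by lra.
rewrite mulrA ler_pM ?expR_ge0//.
  by rewrite -[leRHS]lnK ?ler_expR// posrE divr_gt0//; lra.
rewrite expRN div1r lef_pV2 ?posrE ?expR_gt0 ?powR_gt0//.
rewrite /powR gt_eqF// ler_expR ler_wpM2l//; first by lra.
by rewrite ler_ln ?posrE//; lra.
Qed.
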